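(* Let $f:X\to Y$ be a regular local homeomorphism between metric spaces. Suppose that $X$ is complete and $Y$ is path-connected and locally $\mathcal R$-contractible. If $f$ satisfies the Hadamard integral condition, then $f$ is a covering projection.
   Context: For non-isolated $x\in X$, $D_x^-f=\liminf_{z\to x,\,z\neq x}\frac{d(f(z),f(x))}{d(z,x)}$; $X$ is assumed to have no isolated points. $f$ is regular if $0<D_x^-f<\infty$ for every $x\in X$. $f$ satisfies the Hadamard integral condition if for some $x_0\in X$, $\int_0^\infty\inf_{x\in\overline{B_t(x_0)}}D_x^-f\,dt=\infty$, where $\overline{B_t(x_0)}=\{x:d(x,x_0)\le t\}$. A path $p:[0,1]\to Y$ is rectifiable if its length $\sup\sum_i d(p(t_i),p(t_{i+1}))$ over partitions is finite. $Y$ is locally $\mathcal R$-contractible if every $y_0\in Y$ has an open neighborhood $U$ with a continuous homotopy $H:U\times[0,1]\to U$ such that $H(y_0,t)=y_0$ for all $t$, $H(y,0)=y_0$, $H(y,1)=y$ for all $y\in U$, and each path $t\mapsto H(y,t)$ is rectifiable. *)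

(* Defs.v *)
From HB Require Import structures.
From mathcomp Require Import all_boot all_order all_algebra.
From mathcomp Require Import all_classical all_reals all_analysis.
Set Implicit Arguments. Unset Strict Implicit. Unset Printing Implicit Defensive.
Import Order.TTheory GRing.Theory Num.Theory.
Local Open Scope classical_set_scope.
Local Open Scope ring_scope.

Section MetricDefs.
Variable R : realType.

Definition is_metric (T : Type) (d : T -> T -> R) : Prop :=
  [/\ forall x y, 0 <= d x y,
      forall x y, d x y = 0 <-> x = y,
      forall x y, d x y = d y x &
      forall x y z, d x z <= d x y + d y z].

Definition mopen (T : Type) (d : T -> T -> R) (U : set T) : Prop :=
  forall x, U x -> exists2 e : R, 0 < e & forall z, d x z < e -> U z.

Definition no_isolated (T : Type) (d : T -> T -> R) : Prop :=
  forall x (e : R), 0 < e -> exists z, z <> x /\ d x z < e.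

Definition mcont_on (S T : Type) (dS : S -> S -> R) (dT : T -> T -> R)
  (A : set S) (f : S -> T) : Prop :=
  forall x, A x -> forall e : R, 0 < e -> exists2 del : R, 0 < del &
    forall z, A z -> dS x z < del -> dT (f x) (f z) < e.

Definition mcontinuous (S T : Type) (dS : S -> S -> R) (dT : T -> T -> R)
  (f : S -> T) : Prop := mcont_on dS dT setT f.

Definition homeo_onto (S T : Type) (dS : S -> S -> R) (dT : T -> T -> R)
  (f : S -> T) (U : set S) (V : set T) : Prop :=
  [/\ f @` U = V, {in U &, injective f}, mcont_on dS dT U f &
      exists g : T -> S, [/\ g @` V `<=` U, {in V, cancel g f},
                             {in U, cancel f g} & mcont_on dT dS V g]].

Definition local_homeo (S T : Type) (dS : S -> S -> R) (dT : T -> T -> R)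
  (f : S -> T) : Prop :=
  forall x, exists U : set S,
    [/\ mopen dS U, U x, mopen dT (f @` U) & homeo_onto dS dT f U (f @` U)].

Definition covering_projection (S T : Type) (dS : S -> S -> R)
  (dT : T -> T -> R) (f : S -> T) : Prop :=
  [/\ mcontinuous dS dT f, (forall y, exists x, f x = y) &
      forall y, exists V : set T, [/\ mopen dT V, V y &
        exists F : set (set S),
          [/\ (forall U, F U -> mopen dS U /\ homeo_onto dS dT f U V),
              (forall U1 U2, F U1 -> F U2 -> U1 `&` U2 !=set0 -> U1 = U2) &
              \bigcup_(U in F) U = f @^-1` V ] ] ].

Definition cauchy_seq (T : Type) (d : T -> T -> R) (u : nat -> T) : Prop :=
  forall e : R, 0 < e -> exists N, forall m n, (N <= m)%N -> (N <= n)%N ->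
    d (u m) (u n) < e.

Definition mcomplete (T : Type) (d : T -> T -> R) : Prop :=
  forall u : nat -> T, cauchy_seq d u ->
    exists l, forall e : R, 0 < e -> exists N, forall n, (N <= n)%N ->
      d (u n) l < e.

Definition lower_dini (S T : Type) (dS : S -> S -> R) (dT : T -> T -> R)
  (f : S -> T) (x : S) : \bar R :=
  ereal_sup [set ereal_inf [set ((dT (f z) (f x)) / (dS z x))%:E
                           | z in [set z | 0 < dS z x < r]]
            | r in [set r : R | 0 < r]].

Definition regular (S T : Type) (dS : S -> S -> R) (dT : T -> T -> R)
  (f : S -> T) : Prop :=
  forall x, (0 < lower_dini dS dT f x)%E /\ (lower_dini dS dT f x < +oo)%E.

Definition closed_mball (T : Type) (d : T -> T -> R) (x0 : T) (t : R) : set T :=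
  [set x | d x x0 <= t].

Definition hadamard_cond (S T : Type) (dS : S -> S -> R) (dT : T -> T -> R)
  (f : S -> T) : Prop :=
  exists x0 : S,
    (\int[@lebesgue_measure R]_(t in `[0%R, +oo[%classic)
        ereal_inf [set lower_dini dS dT f x | x in closed_mball dS x0 t])%E
    = +oo%E.

(* a path p : [0,1] -> T is represented by a function R -> T, only its
   values on [0,1] matter *)
Definition mpath (T : Type) (d : T -> T -> R) (p : R -> T) : Prop :=
  mcont_on (fun s t : R => `|s - t|) d `[0, 1]%classic p.

Definition path_connected (T : Type) (d : T -> T -> R) : Prop :=
  forall y1 y2 : T, exists p : R -> T, [/\ mpath d p, p 0 = y1 & p 1 = y2].

(* sum of d(p t_{i-1}, p t_i) for a partition 0 = t_0 <= t_1 <= ... <= t_n = 1,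
   the points t_1, ..., t_n being listed in ts *)
Definition partition_sum (T : Type) (d : T -> T -> R) (p : R -> T)
  (ts : seq R) : R :=
  \sum_(i < size ts) d (p (nth 0 (0 :: ts) i)) (p (nth 0 ts i)).

Definition rectifiable (T : Type) (d : T -> T -> R) (p : R -> T) : Prop :=
  exists M : R, forall ts : seq R,
    path <=%R 0 ts -> last 0 ts = 1 -> partition_sum d p ts <= M.

Definition locally_R_contractible (T : Type) (d : T -> T -> R) : Prop :=
  forall y0 : T, exists U : set T, exists H : T -> R -> T,
    [/\ mopen d U /\ U y0,
        (forall y t, U y -> 0 <= t <= 1 -> forall e : R, 0 < e ->
           exists2 del : R, 0 < del & forall y' t', U y' -> 0 <= t' <= 1 ->
             d y y' < del -> `|t - t'| < del -> d (H y t) (H y' t') < e),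
        (forall y t, U y -> 0 <= t <= 1 -> U (H y t)),
        (forall t, 0 <= t <= 1 -> H y0 t = y0) &
        forall y, U y -> [/\ H y 0 = y0, H y 1 = y & rectifiable d (H y)]].

End MetricDefs.

(* Main.v *)
Require Import Defs.
From HB Require Import structures.
From mathcomp Require Import all_boot all_order all_algebra.
From mathcomp Require Import all_classical all_reals all_analysis.
From mathcomp Require Import measurable_realfun lra.

(* Let a(t) be the infimum of D^-f over the ball B_t(x0), and Phi a primitive of
   the nonincreasing function a. Along a lift q of a path of length l,
   Phi(d(q(t), x0)) grows at most like 2 l(t); since Phi is unbounded by the
   Hadamard condition, q stays in a ball B_M(x0). There D^-f >= a(M) > 0, so q
   is Lipschitz with respect to l and converges at the end of every interval on
   which it is defined, by completeness of X. Hence rectifiable paths lift.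

   A neighborhood U that contracts to y0 along rectifiable paths is evenly
   covered: the sheet through a point x over y0 is the image of the section that
   maps y to the endpoint of the lift, starting at x, of the path H(y, .).
   Surjectivity follows as a path in Y between any two points cannot leave the
   image of f, each such U being contained in or disjoint from it. *)

Set Implicit Arguments. Unset Strict Implicit. Unset Printing Implicit Defensive.
Import Order.TTheory GRing.Theory Num.Theory.
Local Open Scope classical_set_scope.
Local Open Scope ring_scope.

(** * Induction along a real interval and a mean value inequality *)

Section RealInduction.
Variables (R : realType) (a b : R) (P : R -> Prop).

(** Consider the supremum of the points up to which [P] holds throughout. The left-limit hypothesis
    gives [P] there, and the right-extension hypothesis would push past it if it were less than
    [b]. *)
Lemma real_induction :
  P a ->
  (forall t, a <= t < b -> P t ->
     exists2 e : R, 0 < e & forall s, t < s < t + e -> s <= b -> P s) ->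
  (forall t, a < t <= b -> (forall s, a <= s < t -> P s) -> P t) ->
  forall t, a <= t <= b -> P t.
Proof.
move=> Pa Pr Pl t /andP[at_ tb].
have ab : a <= b by exact: le_trans tb.
pose S : set R := [set t | a <= t <= b /\ forall s, a <= s <= t -> P s].
have Sa : S a.
  split=> [|s]; first by rewrite lexx ab.
  by rewrite -eq_le => /eqP <-.
have supS : has_sup S.
  by split; [exists a | exists b => x [/andP[]]].
have Sb x : S x -> x <= sup S by move=> Sx; exact: ub_le_sup (proj2 supS) _ Sx.
have am : a <= sup S by exact: Sb.
have mb : sup S <= b.
  by apply: ge_sup => [|x [/andP[]]//]; exists a.
have Plt s : a <= s < sup S -> P s.
  case/andP=> as_ sm.
  have [x [_ Sx] sx] := sup_gt (proj1 supS) sm.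
  by apply: Sx; rewrite as_ (ltW sx).
have Pm : P (sup S).
  move: am; rewrite le_eqVlt => /predU1P[<-//|am].
  by apply: Pl => //; rewrite am mb.
have Ple s : a <= s <= sup S -> P s.
  case/andP=> as_; rewrite le_eqVlt => /predU1P[->//|sm].
  by apply: Plt; rewrite as_ sm.
have [mlt|mge] := ltP (sup S) b; last first.
  by apply: Ple; rewrite at_ (le_trans tb).
have [e e0 Pe] := Pr _ (introT andP (conj am mlt)) Pm.
(* A point strictly beyond [sup S], inside [[a, b]] and within reach of [Pe]. *)
pose u := Num.min b (sup S + e / 2).
have mu : sup S < u by rewrite lt_min mlt ltrDl divr_gt0.
have ub : u <= b by rewrite ge_min lexx.
have ue : u < sup S + e by rewrite gt_min ltrD2l ltr_pdivrMr//; apply/orP; right; lra.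
suff /Sb : S u by rewrite leNgt mu.
split=> [|s /andP[as_ su]]; first by rewrite ub (le_trans am (ltW mu)).
have [sm|ms] := leP s (sup S); first by apply: Ple; rewrite as_ sm.
by apply: Pe; [rewrite ms (le_lt_trans su) | exact: le_trans su ub].
Qed.

(** One radius serves both sides of [t]: taking [s = t] gives the right step of [real_induction],
    and taking [s' = t] the left-limit step. *)
Lemma local_propagation :
  (forall t, a <= t <= b -> exists2 e : R, 0 < e &
     forall s s', a <= s -> s <= s' -> s' <= b ->
       `|s - t| < e -> `|s' - t| < e -> P s -> P s') ->
  P a -> forall t, a <= t <= b -> P t.
Proof.
move=> loc Pa; apply: real_induction => // t /andP[at_ tb].
- move=> Pt; have [|e e0 he] := loc t; first by rewrite at_ ltW.
  exists e => // s /andP[ts se] sb.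
  apply: (he t s) => //; first exact: ltW.
  + by rewrite subrr normr0.
  + by rewrite ltr_norml; lra.
- move=> Ps; have [|e e0 he] := loc t; first by rewrite tb ltW.
  pose s := Num.max a (t - e / 2).
  have st : s < t by rewrite gt_max at_ /=; lra.
  have as_ : a <= s by rewrite le_max lexx.
  have es : t - e / 2 <= s by rewrite le_max lexx orbT.
  apply: (he s t) => //; first exact: ltW.
  + by rewrite ltr_norml; lra.
  + by rewrite subrr normr0.
  + by apply: Ps; rewrite as_ st.
Qed.

End RealInduction.

(** A mean value inequality by real induction. At a left limit the continuity of [h] is combined
    with the monotonicity of [l], so [l] may jump, as a length function may. *)
Lemma le_increment (R : realType) (a b : R) (h l : R -> R) :
  a <= b ->
  (forall s t, a <= s -> s <= t -> t <= b -> l s <= l t) ->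
  (forall t, a <= t <= b -> forall e, 0 < e -> exists2 del, 0 < del &
     forall s, a <= s <= b -> `|t - s| < del -> `|h t - h s| < e) ->
  (forall t, a <= t < b -> exists2 e : R, 0 < e &
     forall s, t < s < t + e -> s <= b -> h s - h t <= l s - l t) ->
  h b - h a <= l b - l a.
Proof.
move=> ab lmon hc loc.
apply: (@real_induction _ a b (fun t => h t - h a <= l t - l a)) => //=.
- by rewrite !subrr.
- move=> t tab ht; have [e e0 he] := loc t tab.
  by exists e => // s ts sb; have := he s ts sb; lra.
- move=> t /andP[at_ tb] hs.
  apply/ler_addgt0Pr => e e0.
  have [|d d0 hd] := hc t _ e e0; first by rewrite tb ltW.
  pose s := Num.max a (t - d / 2).
  have st : s < t by rewrite gt_max at_ /=; lra.
  have as_ : a <= s by rewrite le_max lexx.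
  have es : t - d / 2 <= s by rewrite le_max lexx orbT.
  have := hs s; rewrite as_ st => /(_ isT).
  have := lmon s t as_ (ltW st) tb.
  have : `|h t - h s| < e.
    apply: hd; first by rewrite as_ (le_trans (ltW st)).
    by rewrite ltr_norml; lra.
  by rewrite ltr_norml; lra.
- by rewrite ab lexx.
Qed.

(** * The primitive of a nonincreasing function *)

Section Primitive.
Variable R : realType.
Local Notation mu := (@lebesgue_measure R).

(** [Phi r] is the integral of [a] over [[0, r]]. The increment bound holds because [a] is at most
    [a r] to the right of [r]; unboundedness is monotone convergence along the intervals
    [[0, n]]. *)
Lemma nonincreasing_primitive (a : R -> R) :
  nonincreasing_fun a -> (forall t, 0 <= a t) ->
  (\int[mu]_(t in `[0%R, +oo[%classic) (a t)%:E)%E = +oo%E ->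
  exists Phi : R -> R,
  [/\ forall r s, 0 <= r -> r <= s -> Phi r <= Phi s,
      forall r s, 0 <= r -> r <= s -> Phi s - Phi r <= a r * (s - r) &
      forall M, exists2 r, 0 <= r & M < Phi r].
Proof.
move=> ani a0 ay.
have mfa D : measurable D -> measurable_fun D (EFin \o a).
  by move=> mD; apply/measurable_EFinP; exact: nonincreasing_measurable.
pose I r := (\int[mu]_(t in `[0%R, r]%classic) (a t)%:E)%E.
have I0 r : (0 <= I r)%E by apply: integral_ge0 => x _; rewrite lee_fin.
have J r s : r <= s ->
    (\int[mu]_(t in `]r, s]%classic) (a t)%:E <= (a r * (s - r))%:E)%E.
  move=> rs.
  have -> : (a r * (s - r))%:E = (\int[mu]_(t in `]r, s]%classic) (cst (a r)%:E) t)%E.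
    rewrite integral_cst//.  rewrite [X in (_ * X)%E]lebesgue_measure_itv/= lte_fin EFinM.
    by case: ltrgtP rs => // -> _; rewrite subrr.
  apply: ge0_le_integral => //=.
  - by move=> x _; rewrite lee_fin.
  - exact: mfa.
  - by move=> x; rewrite in_itv/= => /andP[rx _]; rewrite lee_fin ani// ltW.
have Isplit r s : 0 <= r -> r <= s ->
    (I s = I r + \int[mu]_(t in `]r, s]%classic) (a t)%:E)%E.
  move=> r0 rs; rewrite /I -ge0_integral_setU//=.
  - congr (integral _ _ _); apply/seteqP; split=> x /=; rewrite !in_itv/=.
    + move=> /andP[x0 xs]; have [xr|rx] := leP x r; first by left; rewrite x0.
      by right; rewrite xs.
    + by case=> /andP[]; [move=> -> /le_trans -> //|move=> rx ->; rewrite andbT ltW// (le_lt_trans r0)].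
  - by apply: mfa; exact: measurableU.
  - by move=> x _; rewrite lee_fin.
  - apply/disj_setPS => x [] /=; rewrite !in_itv/= => /andP[_ xr] /andP[rx _].
    by move: rx; rewrite ltNge xr.
have Ifin r : 0 <= r -> I r \is a fin_num.
  move=> r0; rewrite ge0_fin_numE//.
  have : (I r <= (a 0 * (r - 0) )%:E)%E.
    rewrite /I -integral_itv_obnd_cbnd; last exact: mfa.
    exact: J.
  by move=> /le_lt_trans; apply; rewrite ltry.
have Jge r s : (0 <= \int[mu]_(t in `]r, s]%classic) (a t)%:E)%E.
  by apply: integral_ge0 => x _; rewrite lee_fin.
have E r s : 0 <= r -> r <= s ->
    fine (I s) - fine (I r) = fine (\int[mu]_(t in `]r, s]%classic) (a t)%:E)%E.
  move=> r0 rs; rewrite (Isplit r s)// fineD ?Ifin//; first by rewrite addrC addKr.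
  by rewrite ge0_fin_numE// (le_lt_trans (J _ _ rs))// ltry.
exists (fun r => fine (I r)); split.
- by move=> r s r0 rs; rewrite -subr_ge0 E// fine_ge0.
- move=> r s r0 rs; rewrite E// -lee_fin fineK ?J//.
  by rewrite ge0_fin_numE// (le_lt_trans (J _ _ rs))// ltry.
- move=> M; apply: contrapT => hM.
  have IM r : 0 <= r -> (I r <= M%:E)%E.
    move=> r0; rewrite -(fineK (Ifin _ r0)) lee_fin leNgt; apply/negP => Mr.
    by apply: hM; exists r.
  suff : (+oo <= M%:E :> \bar R)%E by rewrite leye_eq.
  have U : `[0%R, +oo[%classic = \bigcup_n `[0%R, n%:R : R]%classic.
    apply/seteqP; split=> x /=.
    - rewrite in_itv/= andbT => x0; exists (Num.bound x) => //=.
      by rewrite in_itv/= x0 ltW// (le_lt_trans _ (archi_boundP x0)).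
    - by move=> [n _]/=; rewrite !in_itv/= => /andP[-> _].
  have cv : (I n%:R @[n --> \oo] -->
      \int[mu]_(x in \bigcup_n `[0%R, n%:R : R]%classic) (a x)%:E)%E.
    apply: (@ge0_nondecreasing_set_cvg_integral _ (measurableTypeR R) R (fun n => `[0%R, n%:R : R]%classic) (EFin \o a) (@lebesgue_measure R)).
    - move=> m n mn; apply/subsetPset => x /=; rewrite !in_itv/= => /andP[-> xm]/=.
      by rewrite (le_trans xm)// ler_nat.
    - by move=> i; exact: measurable_itv.
    - by move=> i; apply: mfa.
    - by move=> i x _; rewrite lee_fin.
  rewrite -ay U -(cvg_lim (@ereal_hausdorff R) cv).
  apply: lime_le; first by apply/cvg_ex; eexists; exact: cv.
  by apply: nearW => n; exact: IM.
Qed.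

End Primitive.

(** Let [l t] be the supremum of the partition sums over [[0, t]]. Appending [t] to a partition of
    [[0, s]] adds [d (p s) (p t)]. The suprema are finite since appending [1] yields a partition of
    [[0, 1]], whose sum is at most [M]. *)
Lemma rectifiable_arc_length (R : realType) (T : Type) (d : T -> T -> R) (p : R -> T) :
  rectifiable d p ->
  exists l : R -> R, forall s t, 0 <= s -> s <= t -> t <= 1 ->
    d (p s) (p t) <= l t - l s.
Proof.
move=> [M hM].
pose A t := [set partition_sum d p ts | ts in [set ts | path <=%R 0 ts /\ last 0 ts = t]].
have ext ts t : path <=%R 0 ts -> last 0 ts <= t ->
    path <=%R 0 (rcons ts t) /\ partition_sum d p (rcons ts t) =
      partition_sum d p ts + d (p (last 0 ts)) (p t).
  move=> pts lt; split; first by rewrite rcons_path pts.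
  rewrite /partition_sum size_rcons big_ord_recr/=; congr (_ + d (p _) (p _)).
  - apply: eq_bigr => i _; rewrite nth_rcons ltn_ord; congr (d (p _) _).
    by rewrite -rcons_cons nth_rcons/= ltnS ltnW.
  - by rewrite -rcons_cons nth_rcons/= ltnSn -[in RHS](nth_last 0)/=; case: (ts) => //= x s.
  - by rewrite nth_rcons ltnn eqxx.
have Aub t : t <= 1 -> has_ubound (A t).
  move=> t1; exists (M - d (p t) (p 1)) => _ [ts [pts lts] <-].
  have [|p1 E] := ext ts 1 pts; first by rewrite lts.
  by have := hM _ p1 (last_rcons _ _ _); rewrite E lts; lra.
have Ane t : 0 <= t -> A t !=set0.
  move=> t0; exists (partition_sum d p [:: t]); exists [:: t] => //=.
  by rewrite t0.
exists (fun t => sup (A t)) => s t s0 st t1.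
rewrite lerBrDl -lerBrDr; apply: ge_sup; first exact: Ane.
move=> _ [ts [pts lts] <-].
have [|pt E] := ext ts t pts; first by rewrite lts.
rewrite lerBrDr -lts -E; apply: ub_le_sup; first exact: Aub.
by exists (rcons ts t) => //; split=> //; rewrite last_rcons.
Qed.

(** * Elementary facts about metrics *)

Section MetricFacts.
Variables (R : realType) (T : Type) (d : T -> T -> R).
Hypothesis mT : is_metric d.

Lemma metric_ge0 x y : 0 <= d x y. Proof. by case: mT. Qed.
Lemma metric_refl x : d x x = 0. Proof. by case: mT => _ h _ _; apply/h. Qed.
Lemma metric_sym x y : d x y = d y x. Proof. by case: mT. Qed.
Lemma metric_tri y x z : d x z <= d x y + d y z. Proof. by case: mT. Qed.

Lemma metric_eq x y : (forall e, 0 < e -> d x y <= e) -> x = y.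
Proof.
case: mT => h0 h _ _ hd; apply/h/eqP; rewrite eq_le h0 andbT.
by apply/ler_addgt0Pr => e e0; rewrite add0r hd.
Qed.

Lemma metric_dist z x y : `|d x z - d y z| <= d x y.
Proof.
have := metric_tri y x z; have := metric_tri x y z.
by rewrite (metric_sym y x) ler_norml; lra.
Qed.

End MetricFacts.

(** * Continuous curves on compact intervals *)

Section Curves.
Variables (R : realType) (T : Type) (d : T -> T -> R).

Definition curve (a b : R) (q : R -> T) : Prop :=
  forall t, a <= t <= b -> forall e : R, 0 < e -> exists2 del : R, 0 < del &
    forall s, a <= s <= b -> `|t - s| < del -> d (q t) (q s) < e.

Lemma mpathP q : mpath d q <-> curve 0 1 q.
Proof.
by split=> h t; have := h t; rewrite /= in_itv/= => {}h ht e e0;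
  have [del del0 {}h] := h ht e e0; exists del => // s hs; apply: h;
  move: hs; rewrite /= in_itv.
Qed.

Lemma curve_sub a b a' b' q : a <= a' -> b' <= b -> curve a b q -> curve a' b' q.
Proof.
move=> aa bb h t /andP[t1 t2] e e0.
have [|del del0 {}h] := h t _ e e0; first by rewrite (le_trans aa)// (le_trans t2).
exists del => // s /andP[s1 s2]; apply: h.
by rewrite (le_trans aa)// (le_trans s2).
Qed.

Lemma curve_glue a m b q1 q2 : curve a m q1 -> curve m b q2 -> q1 m = q2 m ->
  curve a b (fun u => if u <= m then q1 u else q2 u).
Proof.
move=> h1 h2 E t /andP[at_ tb] e e0.
have [tm|mt|tm] := ltgtP t m.
- have [|del del0 {}h1] := h1 t _ e e0; first by rewrite at_ ltW.
  exists (Num.min del (m - t)); first by rewrite lt_min del0 subr_gt0.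
  move=> s /andP[as_ sb]; rewrite lt_min => /andP[sd]; rewrite ltr_norml => sm.
  have sm' : s <= m by lra.
  by rewrite sm'; apply: h1 => //; rewrite as_.
- have [|del del0 {}h2] := h2 t _ e e0; first by rewrite tb ltW.
  exists (Num.min del (t - m)); first by rewrite lt_min del0 subr_gt0.
  move=> s /andP[as_ sb]; rewrite lt_min => /andP[sd]; rewrite ltr_norml => sm.
  have sm' : m < s by lra.
  by rewrite leNgt sm'/=; apply: h2 => //; rewrite sb ltW.
- subst t.
  have [|d1 d10 {}h1] := h1 m _ e e0; first by rewrite at_/=.
  have [|d2 d20 {}h2] := h2 m _ e e0; first by rewrite lexx.
  exists (Num.min d1 d2); first by rewrite lt_min d10.
  move=> s /andP[as_ sb]; rewrite lt_min => /andP[sd1 sd2].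
  case: ifPn => [sm|]; first by apply: h1 => //; rewrite as_.
  by rewrite -ltNge E => sm; apply: h2 => //; rewrite sb ltW.
Qed.

Lemma curve_rev q : curve 0 1 q -> curve 0 1 (fun t => q (1 - t)).
Proof.
move=> h t t01 e e0; have [|del del0 {}h] := h (1 - t) _ e e0; first lra.
exists del => // s s01 st; apply: h; first lra.
by move: st; rewrite !ltr_norml; lra.
Qed.

End Curves.

(** * Lifts of paths: uniqueness, extension and existence *)

Section Lifts.
Variables (R : realType) (X Y : Type) (dX : X -> X -> R) (dY : Y -> Y -> R).
Variable f : X -> Y.
Hypotheses (mX : is_metric dX) (mY : is_metric dY) (lh : local_homeo dX dY f).

(** The last clause joins the openness of [V] and the continuity of [g] into a single radius. *)
Definition local_inverse (x : X) (U : set X) (V : set Y) (g : Y -> X) : Prop :=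
  [/\ mopen dX U, U x, forall z, U z -> V (f z) /\ g (f z) = z,
      forall w, V w -> U (g w) /\ f (g w) = w &
      forall w, V w -> forall e : R, 0 < e -> exists2 del : R, 0 < del &
        forall w', dY w w' < del -> V w' /\ dX (g w) (g w') < e].

Lemma local_inverse_ex x : exists U V g, local_inverse x U V g.
Proof.
have [U [oU Ux oV [_ _ _ [g [gU fg gf cg]]]]] := lh x.
exists U, (f @` U), g; split=> //.
- move=> z Uz; split; first by exists z.
  by apply: gf; rewrite inE.
- move=> w Vw; split; first by apply: gU; exists w.
  by apply: fg; rewrite inE.
- move=> w Vw e e0.
  have [d1 d10 h1] := oV w Vw; have [d2 d20 h2] := cg w Vw e e0.
  exists (Num.min d1 d2); first by rewrite lt_min d10.
  move=> w'; rewrite lt_min => /andP[w1 w2].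
  have Vw' := h1 _ w1; split=> //.
  exact: h2.
Qed.

Lemma local_homeo_continuous : mcontinuous dX dY f.
Proof.
move=> x _ e e0; have [U [oU Ux _ [_ _ cf _]]] := lh x.
have [d1 d10 h1] := oU x Ux; have [d2 d20 h2] := cf x Ux e e0.
exists (Num.min d1 d2); first by rewrite lt_min d10.
move=> z _; rewrite lt_min => /andP[w1 w2].
by apply: h2 => //; exact: h1.
Qed.

Definition lift (a b : R) (p : R -> Y) (q : R -> X) : Prop :=
  curve dX a b q /\ forall t, a <= t <= b -> f (q t) = p t.

Lemma lift_sub a b a' b' p q :
  a <= a' -> b' <= b -> lift a b p q -> lift a' b' p q.
Proof.
move=> aa bb [cq h]; split; first exact: curve_sub cq.
by move=> t /andP[t1 t2]; apply: h; rewrite (le_trans aa)// (le_trans t2).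
Qed.

(** Agreement extends to the right because [f] is injective near the common point, and passes to
    left limits by continuity. *)
Lemma lift_unique a b p q1 q2 : lift a b p q1 -> lift a b p q2 ->
  q1 a = q2 a -> forall t, a <= t <= b -> q1 t = q2 t.
Proof.
move=> [c1 l1] [c2 l2] Ea.
apply: (@real_induction _ a b (fun t => q1 t = q2 t) Ea).
- move=> t /andP[at_ tb] E.
  have tab : a <= t <= b by rewrite at_ ltW.
  have [U [V [g [oU Ut gf fg _]]]] := local_inverse_ex (q1 t).
  have [e e0 he] := oU _ Ut.
  have [d1 d10 h1] := c1 t tab e e0; have [d2 d20 h2] := c2 t tab e e0.
  exists (Num.min d1 d2); first by rewrite lt_min d10.
  move=> s /andP[ts]; rewrite -ltrBlDl lt_min => /andP[s1 s2] sb.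
  have sab : a <= s <= b by rewrite sb (le_trans at_ (ltW ts)).
  have ns : `|t - s| = s - t by rewrite distrC ger0_norm// subr_ge0 ltW.
  have U1 : U (q1 s) by apply: he; apply: h1 => //; rewrite ns.
  have U2 : U (q2 s) by apply: he; rewrite E; apply: h2 => //; rewrite ns.
  by rewrite -(gf _ U1).2 -(gf _ U2).2 l1// l2.
- move=> t /andP[at_ tb] E; apply: (metric_eq mX) => e e0.
  have tab : a <= t <= b by rewrite tb ltW.
  have e20 : 0 < e / 2 by rewrite divr_gt0.
  have [d1 d10 h1] := c1 t tab _ e20; have [d2 d20 h2] := c2 t tab _ e20.
  pose m := Num.min d1 d2.
  have m0 : 0 < m by rewrite lt_min d10.
  have [m1 m2] : m <= d1 /\ m <= d2 by rewrite !ge_min !lexx orbT.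
  pose s := Num.max a (t - m / 2).
  have st : s < t by rewrite gt_max at_ /=; lra.
  have as_ : a <= s by rewrite le_max lexx.
  have es : t - m / 2 <= s by rewrite le_max lexx orbT.
  have sab : a <= s <= b by rewrite as_ (le_trans (ltW st)).
  have ns : `|t - s| = t - s by rewrite ger0_norm// subr_ge0 ltW.
  have := h1 s sab; rewrite ns => /(_ ltac:(lra)).
  have := h2 s sab; rewrite ns => /(_ ltac:(lra)).
  have := metric_tri mX (q1 s) (q1 t) (q2 t).
  have -> : q1 s = q2 s by apply: E; rewrite as_.
  by rewrite (metric_sym mX (q2 s)); lra.
Qed.

Lemma lift_rev p q : lift 0 1 p q ->
  lift 0 1 (fun t => p (1 - t)) (fun t => q (1 - t)).
Proof.
move=> [cq h]; split; first exact: curve_rev.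
by move=> t t01; apply: h; lra.
Qed.

Lemma local_inverse_lift x U V g a b p :
  local_inverse x U V g -> curve dY a b p -> (forall t, a <= t <= b -> V (p t)) ->
  lift a b p (g \o p).
Proof.
move=> [_ _ _ fg cg] cp Vp; split=> [t tab e e0|t tab]; last first.
  exact: (fg _ (Vp t tab)).2.
have [d1 d10 h1] := cg _ (Vp t tab) e e0.
have [d2 d20 h2] := cp t tab d1 d10.
by exists d2 => // s sab st; exact: (h1 _ (h2 _ sab st)).2.
Qed.

(** By uniqueness of lifts, since [g] sends [p a] to [q a]. It lets the lifts of all nearby paths be
    expressed by the same [g]. *)
Lemma lift_local_inverse x U V g a b p q :
  local_inverse x U V g -> curve dY a b p -> (forall t, a <= t <= b -> V (p t)) ->
  lift a b p q -> U (q a) -> forall t, a <= t <= b -> q t = g (p t).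
Proof.
move=> li cp Vp lq Ua t tab.
have ab : a <= b by case/andP: tab; exact: le_trans.
apply: (lift_unique lq (local_inverse_lift li cp Vp)) => //=.
case: li => _ _ gf _ _; rewrite -(gf _ Ua).2.
by case: lq => _ -> //=; rewrite lexx ab.
Qed.

(** Only increments of [l] matter, so reversing a path just replaces [l t] by [- l (1 - t)]. *)
Definition controls_length (l : R -> R) (p : R -> Y) : Prop :=
  forall s t, 0 <= s -> s <= t -> t <= 1 -> dY (p s) (p t) <= l t - l s.

Lemma controls_length_le l p s t : controls_length l p ->
  0 <= s -> s <= t -> t <= 1 -> l s <= l t.
Proof.
move=> lp s0 st t1; rewrite -subr_ge0; apply: le_trans (lp _ _ s0 st t1).
exact: metric_ge0.
Qed.

(* [l] plays the role of the arc length of [p]. The constant [C] depends only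
   on the starting point and on a bound for the length, not on the path. *)
Definition Lipschitz_lifting : Prop := forall x L, exists2 C : R, 0 <= C &
  forall p q l T, T <= 1 -> controls_length l p ->
    l 1 - l 0 <= L -> lift 0 T p q -> q 0 = x ->
    forall s t, 0 <= s -> s <= t -> t <= T -> dX (q s) (q t) <= C * (l t - l s).

(** Near [T] the path stays in the domain of a local inverse at [q T], whose composite with [p] is
    glued to [q]. *)
Lemma lift_ext_right T p q : T < 1 -> 0 <= T -> curve dY 0 1 p -> lift 0 T p q ->
  exists2 e : R, 0 < e & forall s, T < s < T + e -> s <= 1 ->
    exists2 q', lift 0 s p q' & q' 0 = q 0.
Proof.
move=> T1 T0 cp [cq lq].
have [U [V [g li]]] := local_inverse_ex (q T).
have [oU UT gf fg cg] := li.
have T01 : 0 <= T <= 1 by rewrite T0 ltW.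
have VT : V (p T) by rewrite -lq ?T0 ?lexx//; exact: (gf _ UT).1.
have [d1 d10 h1] := cg _ VT 1 ltr01.
have [d2 d20 h2] := cp T T01 d1 d10.
exists d2 => // s /andP[Ts sd] s1.
have Vp t : T <= t <= s -> V (p t).
  case/andP=> Tt ts; apply: (h1 _ _).1; apply: h2; last by rewrite ltr_norml; lra.
  by rewrite (le_trans T0)// (le_trans ts).
have [cg' lg] := local_inverse_lift li (curve_sub T0 s1 cp) Vp.
exists (fun u => if u <= T then q u else (g \o p) u); last by rewrite T0.
split.
- apply: curve_glue => //=.
  by rewrite -lq ?T0 ?lexx// (gf _ UT).2.
- move=> t /andP[t0 ts]; case: ifPn => [tT|]; first by rewrite lq// t0.
  by rewrite -ltNge => Tt; apply: lg; rewrite ts ltW.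
Qed.

Hypothesis cX : mcomplete dX.

(** The lifts on the intervals [[0, s]] agree by uniqueness and define [q] before [T]. The Lipschitz
    bound makes [q] Cauchy at [T]; completeness gives a limit [x'], which lies over [p T] by
    continuity of [f]. *)
Lemma lift_ext_left T p l x : 0 < T -> T <= 1 -> Lipschitz_lifting ->
  curve dY 0 1 p -> controls_length l p ->
  (forall s, 0 <= s < T -> exists2 q, lift 0 s p q & q 0 = x) ->
  exists2 q, lift 0 T p q & q 0 = x.
Proof.
move=> T0 T1 LL cp lp ex.
have [C C0 hC] := LL x (l 1 - l 0).
have /choice[Q hQ] : forall s, exists q,
    0 <= s < T -> lift 0 s p q /\ q 0 = x.
  move=> s; have [sT|sT] := boolP (0 <= s < T); last by exists (fun _ => x).
  by have [q h1 h2] := ex s sT; exists q.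
have QE u s : 0 <= u -> u <= s -> s < T -> Q s u = Q u u.
  move=> u0 us sT.
  have [ls s0'] := hQ s ltac:(by rewrite (le_trans u0 us)).
  have [lu u0'] := hQ u ltac:(by rewrite u0 (le_lt_trans us)).
  apply: (lift_unique (lift_sub (lexx 0) us ls) lu); last by rewrite u0 lexx.
  by rewrite s0'.
(* By [QE] the diagonal is the common extension of the chosen lifts. *)
pose q s := Q s s.
have qd s t : 0 <= s -> s <= t -> t < T -> dX (q s) (q t) <= C * (l t - l s).
  move=> s0 st tT; rewrite /q -(QE s t)//.
  have [lt_ t0] := hQ t ltac:(by rewrite (le_trans s0 st)).
  by apply: (hC p (Q t) l t) => //; rewrite (le_trans (ltW tT)).
(* The increasing function [l] has a left limit at [T], so [q] is Cauchy there. *)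
have cauchy e : 0 < e -> exists2 s, 0 <= s < T &
    forall t u, s <= t < T -> s <= u < T -> dX (q t) (q u) < e.
  move=> e0.
  pose A := [set l s | s in [set s | 0 <= s < T]].
  have supA : has_sup A.
    split; first by exists (l 0), 0 => //=; rewrite lexx.
    exists (l 1) => _ [s /andP[s0 sT] <-].
    by apply: (controls_length_le lp) => //; rewrite (le_trans (ltW sT)).
  (* Adding 1 keeps the divisor positive when [C = 0]. *)
  pose e' := e / (C + 1).
  have C1 : 0 < C + 1 by lra.
  have e'0 : 0 < e' by rewrite divr_gt0.
  have [_ [s /andP[s0 sT] <-] hs] := sup_adherent e'0 supA.
  exists s; first by rewrite s0.
  have main t u : s <= t -> t <= u -> u < T -> dX (q t) (q u) < e.
    move=> st tu uT.
    have t0 : 0 <= t by exact: le_trans st.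
    apply: le_lt_trans (qd _ _ t0 tu uT) _.
    have u1 : u <= 1 by rewrite (le_trans (ltW uT)).
    have lst : l s <= l t by apply: (controls_length_le lp) => //; exact: le_trans u1.
    have ltu : l t <= l u by exact: (controls_length_le lp).
    have lu : l u <= sup A.
      by apply: ub_le_sup; [exact: supA.2|exists u => //=; rewrite uT (le_trans t0)].
    have -> : e = (C + 1) * e' by rewrite /e' mulrC divfK// gt_eqF.
    have : C * (l u - l t) <= C * e' by rewrite ler_wpM2l//; lra.
    by lra.
  move=> t u /andP[st tT] /andP[su uT].
  have [tu|ut] := leP t u; first exact: main.
  by rewrite (metric_sym mX); apply: main => //; exact: ltW.
(* Completeness is sequential, so the limit is first taken along a sequence tending to [T]; [lim]
   then extends it to all [t] tending to [T] from below. *)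
pose tn (n : nat) : R := T - T / n.+1%:R.
have tnT n : tn n < T by rewrite /tn ltrBlDr ltrDl divr_gt0.
have tn0 s : s < T -> exists N : nat, forall n, (N <= n)%N -> s <= tn n.
  move=> sT; exists (Num.bound (T / (T - s))) => n Nn.
  rewrite /tn lerBrDl -lerBrDr ler_pdivrMr//.
  have Ts : 0 < T - s by rewrite subr_gt0.
  rewrite mulrC -ler_pdivrMr//.
  have TTs : 0 <= T / (T - s) by rewrite divr_ge0// ltW.
  apply: le_trans (ltW (archi_boundP TTs)) _.
  by rewrite ler_nat leqW.
have [x' hx'] : exists x', forall e : R, 0 < e -> exists N : nat, forall n,
    (N <= n)%N -> dX (q (tn n)) x' < e.
  apply: cX => e e0; have [s /andP[s0 sT] hs] := cauchy e e0.
  have [N hN] := tn0 s sT; exists N => m n Nm Nn.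
  by apply: hs; rewrite tnT hN.
have lim e : 0 < e -> exists2 s, 0 <= s < T &
    forall t, s <= t < T -> dX x' (q t) < e.
  move=> e0; have e20 : 0 < e / 2 by rewrite divr_gt0.
  have [s /andP[s0 sT] hs] := cauchy _ e20; exists s; first by rewrite s0.
  move=> t tsT; have [N hN] := tn0 s sT; have [M hM] := hx' _ e20.
  pose n := maxn N M.
  have h1 := hM n (leq_maxr _ _).
  have h2 := hs (tn n) t ltac:(by rewrite tnT hN// leq_maxl) tsT.
  by have := metric_tri mX (q (tn n)) x' (q t); rewrite (metric_sym mX x' (q (tn n))); lra.
exists (fun t => if t < T then q t else x'); last first.
  by rewrite T0; apply: (hQ 0 _).2; rewrite lexx.
have fx' : f x' = p T.
  apply: (metric_eq mY) => e e0; have e20 : 0 < e / 2 by rewrite divr_gt0.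
  have [d1 d10 h1] := local_homeo_continuous (x := x') I e20.
  have [|d2 d20 h2] := cp T _ _ e20; first by rewrite ltW.
  have [s /andP[s0 sT] hs] := lim _ d10.
  pose t := Num.max s (T - d2 / 2).
  have st : s <= t by rewrite le_max lexx.
  have td : T - d2 / 2 <= t by rewrite le_max lexx orbT.
  have tT : t < T by rewrite gt_max sT; lra.
  have t0 : 0 <= t by exact: le_trans st.
  have := h1 (q t) I (hs t ltac:(by rewrite st)).
  have -> : f (q t) = p t.
    by have [[_ ->]//] := hQ t ltac:(by rewrite t0); rewrite t0 lexx.
  have := h2 t ltac:(by rewrite t0 (le_trans (ltW tT))) ltac:(by rewrite ltr_norml; lra).
  by have := metric_tri mY (p t) (f x') (p T); rewrite (metric_sym mY (p T)); lra.
split=> [t /andP[t0 tT] e e0|t /andP[t0 tT]]; last first.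
  case: ltP => tT'; last by have -> : t = T by apply/eqP; rewrite eq_le tT.
  by have [[_ ->]//] := hQ t ltac:(by rewrite t0); rewrite t0 lexx.
case: (ltP t T) => tT'.
(* Up to [s], which lies beyond [t], the function [q] coincides with the single continuous lift
   [Q s]. *)
- pose s := (t + T) / 2.
  have ts : t < s by rewrite /s; lra.
  have sT : s < T by rewrite /s; lra.
  have [[cs _] _] := hQ s ltac:(by rewrite sT (le_trans t0 (ltW ts))).
  have [|d1 d10 h1] := cs t _ e e0; first by rewrite t0 ltW.
  exists (Num.min d1 (s - t)); first by rewrite lt_min d10 subr_gt0.
  move=> u /andP[u0 uT]; rewrite lt_min => /andP[ud1]; rewrite ltr_norml => us.
  have us' : u <= s by lra.
  rewrite (le_lt_trans us' sT) /q -(QE t s) ?(ltW ts)// -(QE u s)//.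
  by apply: h1 => //; rewrite u0.
- have -> : t = T by apply/eqP; rewrite eq_le tT.
  have [s /andP[s0 sT] hs] := lim _ e0.
  exists (T - s); first by rewrite subr_gt0.
  move=> u /andP[u0 uT]; rewrite ltr_norml => us.
  case: ifPn => uT'; last by rewrite (metric_refl mX).
  by apply: hs; rewrite uT' andbT; lra.
Qed.

Lemma lift_exists p l x : Lipschitz_lifting ->
  curve dY 0 1 p -> controls_length l p -> f x = p 0 ->
  exists2 q, lift 0 1 p q & q 0 = x.
Proof.
move=> LL cp lp fx.
apply: (@real_induction _ 0 1 (fun T => exists2 q, lift 0 T p q & q 0 = x)) => /=.
- exists (fun _ => x) => //; split=> [t _ e e0|t].
    by exists 1 => // s _ _; rewrite (metric_refl mX).
  by rewrite -eq_le => /eqP <-.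
- move=> t /andP[t0 t1] [q lq q0].
  have [e e0 he] := lift_ext_right t1 t0 cp lq.
  by exists e => // s ts s1; have [q' ? ?] := he s ts s1; exists q' => //; rewrite -q0.
- by move=> t /andP[t0 t1]; exact: (lift_ext_left t0 t1 LL cp lp).
- by rewrite lexx ler01.
Qed.

End Lifts.

(** * From path lifting to evenly covered neighborhoods *)

Section Covering.
Variables (R : realType) (X Y : Type) (dX : X -> X -> R) (dY : Y -> Y -> R).
Variable f : X -> Y.
Hypotheses (mX : is_metric dX) (mY : is_metric dY) (lh : local_homeo dX dY f).
Hypotheses (cX : mcomplete dX) (LL : Lipschitz_lifting dX dY f).

Section Sheets.
Variables (y0 : Y) (U : set Y) (H : Y -> R -> Y).
Hypothesis oU : mopen dY U.
Hypothesis cH : forall y t, U y -> 0 <= t <= 1 -> forall e : R, 0 < e ->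
  exists2 del : R, 0 < del & forall y' t', U y' -> 0 <= t' <= 1 ->
    dY y y' < del -> `|t - t'| < del -> dY (H y t) (H y' t') < e.
Hypothesis HU : forall y, U y -> [/\ H y 0 = y0, H y 1 = y & rectifiable dY (H y)].

Lemma homotopy_curve y : U y -> curve dY 0 1 (H y).
Proof.
move=> Uy t t01 e e0; have [del del0 h] := cH Uy t01 e0.
by exists del => // s s01 st; apply: h => //; rewrite (metric_refl mY).
Qed.

Lemma homotopy_lift x y : f x = y0 -> U y ->
  exists2 q, lift dX f 0 1 (H y) q & q 0 = x.
Proof.
move=> fx Uy; have [H0 _ /rectifiable_arc_length[l hl]] := HU Uy.
by apply: (lift_exists mX mY lh cX LL (homotopy_curve Uy) hl); rewrite H0.
Qed.

(* Lifting backwards from [t = 1], by running the path in reverse. *)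
Lemma homotopy_colift z : U (f z) ->
  exists2 q, lift dX f 0 1 (H (f z)) q & q 1 = z.
Proof.
move=> Uy; have [_ H1 /rectifiable_arc_length[l hl]] := HU Uy.
(* Reversal swaps the ends of each interval; the sign makes the increments nonnegative again. *)
have hl' : controls_length dY (fun t => - l (1 - t)) (fun t => H (f z) (1 - t)).
  move=> s t s0 st t1; rewrite (metric_sym mY) opprK [leRHS]addrC; apply: hl; lra.
have [|q lq q0] := lift_exists mX mY lh cX LL (curve_rev (homotopy_curve Uy)) hl' (x := z).
  by rewrite subr0 H1.
exists (fun t => q (1 - t)); last by rewrite subrr.
have [cq fq] := lift_rev lq; split=> // t t01.
by rewrite fq//; congr H; lra.
Qed.

(** Lifting [H y] forwards from a point over [y0] ends over [y]; lifting it backwards from a point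
    over [y] reaches a point over [y0]. So the image of [f] contains [U] or misses it. *)
Lemma mem_fiber_image y : U y ->
  (exists x, f x = y) <-> (exists x, f x = y0).
Proof.
move=> Uy; split=> -[x fx].
- have [|q [_ fq] _] := @homotopy_colift x; first by rewrite fx.
  exists (q 0); rewrite fq ?lexx ?ler01// fx.
  by have [] := HU Uy.
- have [q [_ fq] _] := homotopy_lift fx Uy.
  exists (q 1); rewrite fq ?lexx ?ler01//.
  by have [] := HU Uy.
Qed.

Variables (x : X) (Q : Y -> R -> X).
Hypothesis hQ : forall y, U y -> lift dX f 0 1 (H y) (Q y) /\ Q y 0 = x.

(** Continuity in [y] is propagated from [t = 0], where every lift equals [x]. Close to a given [t],
    the lifts for parameters near [y] all equal [g (H y' s')] for one local inverse [g], provided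
    they start in its sheet [W]; continuity at the earlier time [s] ensures this. *)
Lemma lift_homotopy_continuous y t : U y -> 0 <= t <= 1 ->
  forall e, 0 < e -> exists2 del, 0 < del &
    forall y', U y' -> dY y y' < del -> dX (Q y t) (Q y' t) < e.
Proof.
move=> Uy t01; have [[cQ fQ] Qy0] := hQ Uy.
move: t t01; apply: (@local_propagation _ 0 1 (fun t => forall e, 0 < e ->
  exists2 del, 0 < del &
    forall y', U y' -> dY y y' < del -> dX (Q y t) (Q y' t) < e)); last first.
  move=> e e0; exists 1 => // y' Uy' _; have [_ ->] := hQ Uy'.
  by rewrite Qy0 (metric_refl mX).
move=> t t01.
have [W [V [g li]]] := local_inverse_ex lh (Q y t).
have [oW Wt gf fg cg] := li.
have VH : V (H y t) by rewrite -fQ//; exact: (gf _ Wt).1.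
have [d1 d10 h1] := oW _ Wt.
have [d2 d20 h2] := cQ t t01 _ d10.
have [d3 d30 h3] := cg _ VH 1 ltr01.
have [d4 d40 h4] := cH Uy t01 d30.
have m0 : 0 < Num.min d2 d4 by rewrite lt_min d20.
(* [d2] keeps [Q y s] in [W]; [d4], from the joint continuity of [H], keeps [H y' u] in [V] for all
   [y'] near [y] at once. *)
exists (Num.min d2 d4) => // s s' s0 ss s1.
rewrite !lt_min => /andP[sd2 sd4] /andP[sd2' sd4'] Ps e e0.
have s01 : 0 <= s <= 1 by rewrite s0 (le_trans ss).
have s01' : 0 <= s' <= 1 by rewrite s1 (le_trans s0).
have Vs u y' : U y' -> dY y y' < d4 -> s <= u <= s' -> V (H y' u).
  move=> Uy' yy /andP[su us]; apply: (h3 _ _).1; apply: h4 => //.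
    by rewrite (le_trans s0 su) (le_trans us).
  by move: sd4 sd4'; rewrite !ltr_norml; lra.
have Ws : W (Q y s) by apply: h1; apply: h2 => //; rewrite distrC.
have [d5 d50 h5] := oW _ Ws.
have [d6 d60 h6] := Ps _ d50.
have yd : dY y y < d4 by rewrite (metric_refl mY).
have Vs' : V (H y s') by apply: Vs => //; rewrite ss lexx.
have [d7 d70 h7] := cg _ Vs' _ e0.
have [d8 d80 h8] := cH Uy s01' d70.
have E y' : U y' -> dY y y' < d4 -> W (Q y' s) -> Q y' s' = g (H y' s').
  move=> Uy' yy Wy'; have [lq _] := hQ Uy'.
  apply: (lift_local_inverse mX lh li _ _ (lift_sub s0 s1 lq) Wy').
  - exact: curve_sub s0 s1 (homotopy_curve Uy').
  - by move=> u; exact: Vs.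
  - by rewrite ss lexx.
exists (Num.min d4 (Num.min d6 d8)); first by rewrite !lt_min d40 d60.
move=> y' Uy'; rewrite !lt_min => /and3P[y4 y6 y8].
rewrite (E y)// (E y')//; last by apply: h5; exact: h6.
by apply: (h7 _ _).2; apply: h8 => //; rewrite subrr normr0.
Qed.

Let sg y := Q y 1.

Lemma sheet_section y : U y -> f (sg y) = y.
Proof.
move=> Uy; have [[_ h] _] := hQ Uy; rewrite h ?ler01 ?lexx//.
by have [] := HU Uy.
Qed.

(** For [z] near [sg y], the points [z] and [sg (f z)] both lie in a set where [f] is injective and
    have the same image, so they coincide. *)
Lemma sheet_open : mopen dX (sg @` U).
Proof.
move=> _ [y Uy <-].
have [W [V [g [oW Wt gf _ _]]]] := local_inverse_ex lh (sg y).
have [d1 d10 h1] := oW _ Wt.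
have [|d2 d20 h2] := lift_homotopy_continuous Uy _ d10 (t := 1).
  by rewrite ler01 lexx.
have [d3 d30 h3] := oU Uy.
have m0 : 0 < Num.min d2 d3 by rewrite lt_min d20.
have [d4 d40 h4] := local_homeo_continuous lh (x := sg y) I m0.
exists (Num.min d1 d4); first by rewrite lt_min d10.
move=> z; rewrite lt_min => /andP[z1 z4].
have := h4 z I z4; rewrite sheet_section// lt_min => /andP[z2 z3].
have Uz := h3 _ z3.
exists (f z) => //.
have W1 : W (sg (f z)) by apply: h1; exact: h2.
have W2 : W z by exact: h1.
by rewrite -[LHS](gf _ W1).2 -[RHS](gf _ W2).2 sheet_section.
Qed.

Lemma sheet_homeo : homeo_onto dX dY f (sg @` U) U.
Proof.
split.
- apply/seteqP; split=> [_ [_ [y Uy <-] <-]|y Uy]; first by rewrite sheet_section.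
  by exists (sg y); [exists y | rewrite sheet_section].
- move=> _ _ /set_mem[y Uy <-] /set_mem[y' Uy' <-].
  by rewrite !sheet_section// => ->.
- move=> z _ e e0; have [d d0 h] := local_homeo_continuous lh (x := z) I e0.
  by exists d => // z' _; apply: h.
- exists sg; split=> //.
  + by move=> y /set_mem Uy; rewrite sheet_section.
  + by move=> _ /set_mem[y Uy <-]; rewrite sheet_section.
  + move=> y Uy e e0.
    by apply: lift_homotopy_continuous => //; rewrite ler01 lexx.
Qed.

End Sheets.

Hypotheses (pcY : path_connected dY) (lcY : locally_R_contractible dY).

Lemma Lipschitz_lifting_surjective : inhabited X -> forall y, exists x, f x = y.
Proof.
move=> [x1] y.
have [p [/mpathP cp p0 p1]] := pcY (f x1) y.
rewrite -p1.
apply: (@local_propagation _ 0 1 (fun t => exists x, f x = p t)); last first.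
- by rewrite ler01 lexx.
- by exists x1.
move=> t t01.
have [U [H [[oU Ut] cH _ _ HU]]] := lcY (p t).
have [d d0 hd] := oU _ Ut.
have [e e0 he] := cp t t01 d d0.
exists e => // s s' s0 ss s1 se se' h.
have Us : U (p s) by apply: hd; apply: he; [rewrite s0 (le_trans ss)|rewrite distrC].
have Us' : U (p s') by apply: hd; apply: he; [rewrite s1 (le_trans s0)|rewrite distrC].
apply/(mem_fiber_image cH HU Us').
exact/(mem_fiber_image cH HU Us).
Qed.

(** The sheets over [U] are indexed by the fiber of [y0]. They are disjoint by uniqueness of lifts
    read backwards from [t = 1], and they exhaust the preimage of [U] by backward lifting. *)
Lemma Lipschitz_lifting_covering : inhabited X -> covering_projection dX dY f.
Proof.
move=> iX; split.
- exact: local_homeo_continuous.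
- exact: Lipschitz_lifting_surjective.
move=> y0; have [U [H [[oU Uy0] cH _ _ HU]]] := lcY y0.
exists U; split=> //.
have /choice[Q hQ] : forall xy : X * Y, exists q, f xy.1 = y0 -> U xy.2 ->
    lift dX f 0 1 (H xy.2) q /\ q 0 = xy.1.
  move=> [x y] /=.
  have [fx|nfx] := pselect (f x = y0); last by exists (fun _ => x).
  have [Uy|nUy] := pselect (U y); last by exists (fun _ => x).
  by have [q h1 h2] := homotopy_lift cH HU fx Uy; exists q.
have hQx x : f x = y0 -> forall y, U y ->
    lift dX f 0 1 (H y) (Q (x, y)) /\ Q (x, y) 0 = x.
  by move=> fx y; exact: hQ (x, y) fx.
pose sg x y := Q (x, y) 1.
have sgK x y : f x = y0 -> U y -> f (sg x y) = y.
  by move=> fx Uy; exact: (sheet_section HU (hQx x fx)).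
exists [set sg x @` U | x in f @^-1` [set y0]]; split.
- move=> _ [x fx <-]; split.
  + exact: (sheet_open oU cH HU (hQx x fx)).
  + exact: (sheet_homeo cH HU (hQx x fx)).
- move=> _ _ [x fx <-] [x' fx' <-] [_ [[y Uy <-] [y' Uy' E]]].
  have yy : y' = y by rewrite -(sgK x' y')// E sgK.
  subst y'; suff -> : x = x' by [].
  have [lq q0] := hQx x fx y Uy; have [lq' q0'] := hQx x' fx' y Uy.
  rewrite -q0 -q0'.
  (* The two lifts share their endpoint, which is the starting point of the reversed lifts. *)
  have E0 : Q (x, y) (1 - 0) = Q (x', y) (1 - 0) by rewrite subr0.
  have /(_ 1) := lift_unique mX lh (lift_rev lq) (lift_rev lq') E0.
  by rewrite subrr ler01 lexx; apply.
- apply/seteqP; split=> [z [_ [x fx <-] [y Uy <-]]|z Uz /=].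
    by rewrite /= sgK.
  (* The lift ending at [z] starts in the fiber of [y0], so it is one of the lifts defining the
     sheets. *)
  have [q lq q1] := homotopy_colift cH HU Uz.
  have fx : f (q 0) = y0.
    by rewrite lq.2 ?lexx ?ler01//; have [] := HU _ Uz.
  exists (sg (q 0) @` U); first by exists (q 0).
  exists (f z) => //.
  have [lq' q0'] := hQx _ fx _ Uz.
  rewrite -[RHS]q1; apply: (lift_unique mX lh lq' lq) => //.
  by rewrite ler01 lexx.
Qed.

End Covering.

(** * Lipschitz lifting from the Hadamard condition *)

Section Hadamard.
Variables (R : realType) (X Y : Type) (dX : X -> X -> R) (dY : Y -> Y -> R).
Variable f : X -> Y.
Hypotheses (mX : is_metric dX) (mY : is_metric dY).
Local Notation D := (lower_dini dX dY f).

Lemma lower_dini_gt (c : R) x : (c%:E < D x)%E ->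
  exists2 r : R, 0 < r & forall z, dX z x < r -> c * dX z x <= dY (f z) (f x).
Proof.
move=> /ereal_sup_gt[_ [r r0 <-] h]; exists r => // z zr.
have := metric_ge0 mX z x; rewrite le_eqVlt => /predU1P[<-|z0].
  by rewrite mulr0 metric_ge0.
rewrite -ler_pdivlMr// -lee_fin; apply: le_trans (ltW h) _.
by apply: ereal_inf_lbound; exists z => //=; rewrite z0.
Qed.

Hypotheses (lh : local_homeo dX dY f) (reg : regular dX dY f).

(** The increment of [l] bounds the displacement of [p], which is at least [c] times that of [q]
    near [t]. *)
Lemma lift_increment c q p l t T : lift dX f 0 T p q -> T <= 1 ->
  controls_length dY l p -> 0 <= t < T -> (c%:E < D (q t))%E ->
  exists2 e : R, 0 < e & forall s, t < s < t + e -> s <= T ->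
    c * dX (q s) (q t) <= l s - l t.
Proof.
move=> [cq lq] T1 lp /andP[t0 tT] /lower_dini_gt[r r0 hr].
have [|e e0 he] := cq t _ _ r0; first by rewrite t0 ltW.
exists e => // s /andP[ts se] sT.
apply: (@le_trans _ _ (dY (f (q s)) (f (q t)))).
  apply: hr; rewrite (metric_sym mX); apply: he.
    by rewrite sT (le_trans t0 (ltW ts)).
  by rewrite ltr_norml; lra.
rewrite !lq ?t0 ?sT ?(ltW tT) ?(le_trans t0 (ltW ts))// (metric_sym mY).
by apply: lp => //; [exact: ltW | exact: le_trans T1].
Qed.

(** [le_increment] is applied twice: to [Phi] of the distance to [x0] along [q], which confines [q]
    to a ball depending only on [x] and [L], and then to the distance from [q s], which gives the
    Lipschitz bound. *)
Lemma hadamard_Lipschitz_lifting :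
  hadamard_cond dX dY f -> Lipschitz_lifting dX dY f.
Proof.
move=> [x0 hI] x L.
pose F t := ereal_inf [set D z | z in closed_mball dX x0 t].
have F0 t : (0 <= F t)%E.
  by apply: le_ereal_inf_tmp => _ [z _ <-]; exact: ltW (reg z).1.
have FD t z : dX z x0 <= t -> (F t <= D z)%E.
  by move=> zt; apply: ereal_inf_lbound; exists z.
have Fni s t : s <= t -> (F t <= F s)%E.
  move=> st; apply: ereal_inf_le_tmp => _ [z zs <-]; exists z => //.
  exact: le_trans st.
have Ffin t : 0 <= t -> F t \is a fin_num.
  move=> t0; rewrite ge0_fin_numE//.
  by apply: le_lt_trans (FD t x0 _) (reg x0).2; rewrite (metric_refl mX).
(* For negative [t] the ball is empty and [F t] is [+oo]; truncating at 0 keeps [a] finite and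
   nonincreasing on the whole line. *)
pose a t := fine (F (Num.max 0 t)).
have aE t : 0 <= t -> (a t)%:E = F t.
  by move=> t0; rewrite /a (max_idPr t0) fineK// Ffin.
have a0 t : 0 <= a t by exact: fine_ge0.
have max0 t : 0 <= Num.max 0 t :> R by rewrite le_max lexx.
have ani : nonincreasing_fun a.
  move=> s t st; rewrite /a fine_le ?Ffin//; apply: Fni.
  by rewrite ge_max !le_max lexx st orbT.
have [|Phi [Pnd Pinc Pub]] := nonincreasing_primitive ani a0.
  rewrite -hI; apply: eq_integral => t; rewrite inE/= in_itv/= andbT => t0.
  exact: aE.
pose rho z := dX z x0.
have rho0 z : 0 <= rho z by exact: metric_ge0.
have rhod z z' : `|rho z - rho z'| <= dX z z' by exact: metric_dist.
have aD z : ((a (rho z))%:E <= D z)%E by rewrite aE// FD.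
have Dfin z : D z \is a fin_num.
  by rewrite ge0_fin_numE ?(reg z).2// ltW// (reg z).1.
have PLip r s : 0 <= r -> 0 <= s -> `|Phi r - Phi s| <= a 0 * `|r - s|.
  have main u v : 0 <= u -> u <= v -> `|Phi u - Phi v| <= a 0 * `|u - v|.
    move=> u0 uv; rewrite (distrC (Phi u)) (distrC u) !ger0_norm ?subr_ge0 ?Pnd//.
    apply: le_trans (Pinc _ _ u0 uv) _.
    by rewrite ler_wpM2r ?subr_ge0// ani.
  move=> r0 s0; have [rs|sr] := leP r s; first exact: main.
  by rewrite distrC (distrC r); apply: main => //; exact: ltW.
(* [2 * L] bounds the total growth of [Phi (rho (q t))] along a lift starting at [x]. *)
have [M M0 hM] := Pub (Phi (rho x) + 2 * L).
(* Otherwise [Phi] would not grow beyond [M], against its unboundedness. *)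
have aM : 0 < a M.
  rewrite lt_neqAle a0 andbT; apply/eqP => aM.
  have [r r0] := Pub (Phi M); apply/negP; rewrite -leNgt.
  have [rM|Mr] := leP r M; first exact: Pnd.
  by have := Pinc _ _ M0 (ltW Mr); rewrite -aM mul0r subr_le0.
have bounded p q l T : T <= 1 -> controls_length dY l p -> l 1 - l 0 <= L ->
    lift dX f 0 T p q -> q 0 = x -> forall t, 0 <= t <= T -> rho (q t) <= M.
  move=> T1 lp lL lq q0 t /andP[t0 tT].
  have t1 : t <= 1 by exact: le_trans T1.
  have lqt := lift_sub (lexx 0) tT lq.
  have inc : Phi (rho (q t)) - Phi (rho (q 0)) <= 2 * l t - 2 * l 0.
    apply: (@le_increment _ 0 t (fun u => Phi (rho (q u))) (fun u => 2 * l u)) => //.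
    - move=> u v u0 uv vt; rewrite ler_pM2l//.
      by apply: (controls_length_le mY lp) => //; exact: le_trans t1.
    - move=> u ut e e0.
      have a1 : 0 < a 0 + 1 by rewrite ltr_wpDl.
      have [d d0 hd] := lqt.1 u ut _ (divr_gt0 e0 a1).
      exists d => // s st us.
      apply: le_lt_trans (PLip _ _ (rho0 _) (rho0 _)) _.
      have := hd s st us; rewrite ltr_pdivlMr// mulrC => h.
      apply: le_lt_trans h; rewrite mulrDl mul1r.
      apply: (@le_trans _ _ (a 0 * dX (q u) (q s))); first by rewrite ler_wpM2l.
      by rewrite lerDl metric_ge0.
    - (* Half the Dini derivative is a strict lower bound for the local
         expansion of [f], whence the factor 2 in front of [l]. *)
      move=> u /andP[u0 ut].
      have Du0 : 0 < fine (D (q u)) by rewrite fine_gt0// (reg _).1 (reg _).2.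
      have Du : ((fine (D (q u)) / 2)%:E < D (q u))%E.
        by rewrite -{2}(fineK (Dfin (q u))) lte_fin; lra.
      have [|e e0 he] := lift_increment lqt t1 lp _ Du; first by rewrite u0.
      exists e => // s us st.
      have := he s us st.
      (* Moving towards [x0] does not increase [Phi]. Moving away, its growth is at most
         [a (rho (q u))], hence at most the Dini derivative at [q u], times the displacement of
         [q]. *)
      have [r1|r2] := leP (rho (q s)) (rho (q u)).
        have := Pnd _ _ (rho0 _) r1.
        have : l u <= l s.
          apply: (controls_length_le mY lp) => //; last exact: le_trans t1.
          by case/andP: us => /ltW.
        by lra.
      have := Pinc _ _ (rho0 _) (ltW r2).
      have : a (rho (q u)) * (rho (q s) - rho (q u)) <=
             fine (D (q u)) * dX (q s) (q u).
        apply: ler_pM => //; first by rewrite subr_ge0 ltW.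
          by rewrite -lee_fin (fineK (Dfin _)); exact: aD.
        by apply: le_trans (ler_norm _) (rhod _ _).
      by lra.
  rewrite leNgt; apply/negP => Mr.
  have := Pnd _ _ M0 (ltW Mr).
  have := controls_length_le mY lp t0 t1 (lexx 1).
  by move: inc hM; rewrite q0; lra.
(* On the ball of radius [M] the Dini derivative is at least [a M], hence strictly above [a M / 2],
   whose inverse is the constant. *)
exists (2 / a M); first by rewrite divr_ge0// ltW.
move=> p q l T T1 lp lL lq q0 s t s0 st tT.
have t1 : t <= 1 by exact: le_trans T1.
have lqt := lift_sub (lexx 0) tT lq.
have c0 : 0 <= a M / 2 by lra.
have : a M / 2 * dX (q t) (q s) - a M / 2 * dX (q s) (q s) <= l t - l s.
  apply: (@le_increment _ s t (fun u => a M / 2 * dX (q u) (q s)) l) => //.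
  - move=> u v su uv vt; apply: (controls_length_le mY lp) => //.
      exact: le_trans su.
    exact: le_trans t1.
  - move=> u ut e e0.
    have [d d0 hd] := (curve_sub s0 (lexx t) lqt.1) u ut _ (divr_gt0 e0 aM).
    exists d => // v vt uv.
    have := hd v vt uv; rewrite ltr_pdivlMr// => h.
    have := metric_dist mX (q s) (q u) (q v).
    rewrite -mulrBr normrM ger0_norm//.
    have := metric_ge0 mX (q u) (q v).
    move: h; set m := `|_|; nra.
  - move=> u /andP[su ut].
    have u0 : 0 <= u by exact: le_trans su.
    have Du : ((a M / 2)%:E < D (q u))%E.
      have := FD M (q u) (bounded _ _ _ _ T1 lp lL lq q0 u _).
      rewrite u0 (ltW (lt_le_trans ut tT)) -aE// => /(_ isT).
      by apply: lt_le_trans; rewrite lte_fin; lra.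
    have [|e e0 he] := lift_increment lqt t1 lp _ Du; first by rewrite u0.
    exists e => // v uv vt; apply: le_trans (he v uv vt).
    rewrite -mulrBr ler_wpM2l//.
    by have := metric_tri mX (q u) (q v) (q s); lra.
rewrite (metric_refl mX) mulr0 subr0 (metric_sym mX (q t)) => h.
by rewrite mulrAC ler_pdivlMr//; lra.
Qed.

End Hadamard.

Theorem theorem5 (R : realType) (X Y : Type)
  (dX : X -> X -> R) (dY : Y -> Y -> R) (f : X -> Y) :
  is_metric dX -> is_metric dY -> no_isolated dX ->
  local_homeo dX dY f -> regular dX dY f ->
  mcomplete dX -> path_connected dY -> locally_R_contractible dY ->
  hadamard_cond dX dY f ->
  covering_projection dX dY f.
Proof.
move=> mX mY _ lh reg cX pcY lcY had.
apply: Lipschitz_lifting_covering => //.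
  exact: hadamard_Lipschitz_lifting.
by case: had => x0 _; exists.
Qed.
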